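(* The functors $F \colon \mathbf{AtRepAlg} \to \mathbf{Set_q}^{\mathrm{op}}$ and $G \colon \mathbf{Set_q}^{\mathrm{op}} \to \mathbf{AtRepAlg}$ (defined in the context) form an adjunction, with $F$ left adjoint to $G$; that is, $F \dashv G$.
   Context: **Algebras.** A partial function from $X$ to $Y$ is a set $f\subseteq X\times Y$ such that $(x,y),(x,z)\in f$ implies $y=z$; $\mathrm{dom}(f)=\{x\mid \exists y\,(x,y)\in f\}$; $f\colon X\rightharpoonup Y$ denotes a partial function. An algebra of partial functions of the signature $\{-,\triangleright\}$ is a nonempty set of partial functions from some common set $X$ to some common set $Y$, closed under relative complement $f-g$ (set difference) and domain restriction $f\triangleright g=\{(x,y)\in g\mid x\in\mathrm{dom}(f)\}$. An abstract $\{-,\triangleright\}$-algebra (two binary operations) is representable if it is isomorphic to an algebra of partial functions. Put $a\cdot b:=a-(a-b)$; a representable algebra is partially ordered by $a\le b\iff a\cdot b=a$, with binary meet $\cdot$ and least element $0$. An atom is a minimal nonzero element; $\mathrm{At}(\mathfrak A)$ is the set of atoms; $\mathfrak A$ is atomic if every nonzero element is above an atom. $a^\downarrow=\{x\mid x\le a\}$, which is a Boolean algebra. **Complete homomorphisms.** A homomorphism $h$ of representable $\{-,\triangleright\}$-algebras is complete if it preserves all existing joins (whenever $\sum S$ exists, $\sum h[S]$ exists and equals $h(\sum S)$); for homomorphisms of representable algebras this is equivalent to preserving all existing meets of nonempty subsets. **Categories.** $\mathbf{AtRepAlg}$: objects are atomic representable $\{-,\triangleright\}$-algebras, morphisms are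 complete homomorphisms. $\mathbf{Set_q}$: objects are surjective (total) functions $\pi\colon X\twoheadrightarrow X_0$ between sets; a morphism from $\pi\colon X\twoheadrightarrow X_0$ to $\rho\colon Y\twoheadrightarrow Y_0$ is a partial function $\varphi\colon X\rightharpoonup Y$ such that (Q.1) if $\varphi(x),\varphi(x')$ are defined and $\pi(x)=\pi(x')$ then $\rho(\varphi(x))=\rho(\varphi(x'))$, so that $\widetilde\varphi:=\{(\pi(x),\rho(\varphi(x)))\mid x\in\mathrm{dom}(\varphi)\}$ is a partial function $X_0\rightharpoonup Y_0$; and for every $(x_0,y_0)\in\widetilde\varphi$ the partial map $\varphi_{(x_0,y_0)}\colon\pi^{-1}(x_0)\rightharpoonup\rho^{-1}(y_0)$ obtained by restricting and co-restricting $\varphi$ is (Q.2) injective and (Q.3) surjective (its image is all of $\rho^{-1}(y_0)$). Composition is the usual composition of partial functions. **The functor $F$.** On a representable $\mathfrak A$ let $a\preceq_{\mathfrak A}b\iff a\le b\triangleright a$ (a preorder), and let $\sim_{\mathfrak A}$ be the induced equivalence relation. $F(\mathfrak A)$ is the canonical projection $\pi_{\mathfrak A}\colon\mathrm{At}(\mathfrak A)\twoheadrightarrow\mathrm{At}(\mathfrak A)/{\sim_{\mathfrak A}}$. For a complete homomorphism $h\colon\mathfrak A\to\mathfrak B$, $Fh\colon\mathrm{At}(\mathfrak B)\rightharpoonup\mathrm{At}(\mathfrak A)$ is the partial function with domain $\bigcup_{a\in\mathfrak A}\mathrm{At}(h(a)^\downarrow)$ and, for an atom $y\le h(a)$, $Fh(y)=\varphi_a(y)$,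 where $\varphi_a(y)$ is the atom of $a^\downarrow$ determined by: for all $a'\le a$, $\varphi_a(y)\le a'\iff y\le h(a')$ (this does not depend on the choice of $a$). **The functor $G$.** For $\pi\colon X\twoheadrightarrow X_0$, $G(\pi)=\mathfrak A_\pi$ is the $\{-,\triangleright\}$-algebra of all partial functions $f\colon X_0\rightharpoonup X$ with $f\subseteq\pi^{-1}=\{(\pi(x),x)\mid x\in X\}$. For a morphism $\varphi$ from $\pi\colon X\twoheadrightarrow X_0$ to $\rho\colon Y\twoheadrightarrow Y_0$, $G\varphi\colon\mathfrak A_\rho\to\mathfrak A_\pi$ is $G\varphi(g)=\{(\pi(x),x)\mid x\in\mathrm{dom}(\varphi)\text{ and }(\rho(\varphi(x)),\varphi(x))\in g\}$. *)

(* Defs.v *)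
From mathcomp Require Import all_boot boolp classical_sets.

Set Implicit Arguments.
Unset Strict Implicit.
Unset Printing Implicit Defensive.

Local Open Scope classical_set_scope.
Local Obligation Tactic := idtac.

Record category := Category {
  obj :> Type;
  hom : obj -> obj -> Type;
  idc : forall a, hom a a;
  ccomp : forall a b c, hom b c -> hom a b -> hom a c;
  comp1c : forall a b (f : hom a b), ccomp (idc b) f = f;
  compc1 : forall a b (f : hom a b), ccomp f (idc a) = f;
  compA : forall a b c d (f : hom c d) (g : hom b c) (h : hom a b),
    ccomp f (ccomp g h) = ccomp (ccomp f g) h }.

Arguments hom {C} _ _ : rename.
Arguments idc {C} _ : rename.
Arguments ccomp {C a b d} _ _ : rename.

Definition op (C : category) : category :=
  @Category C (fun a b => hom b a) (fun a => idc a)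
    (fun a b c (g : hom c b) (f : hom b a) => ccomp f g)
    (fun a b f => compc1 f) (fun a b f => comp1c f)
    (fun a b c d f g h => esym (compA h g f)).

Record functor (C D : category) := Functor {
  fobj :> C -> D;
  fmap : forall a b, hom a b -> hom (fobj a) (fobj b);
  fmap1 : forall a, fmap (idc a) = idc (fobj a);
  fmapD : forall a b c (g : hom b c) (f : hom a b),
    fmap (ccomp g f) = ccomp (fmap g) (fmap f) }.

Arguments fmap {C D} F {a b} _ : rename.

Definition left_adjoint (C D : category) (F : functor C D) (G : functor D C) :
    Prop :=
  exists Phi : forall (a : C) (b : D), hom (F a) b -> hom a (G b),
    (forall a b, bijective (Phi a b)) /\
    (forall (a a' : C) (b b' : D)
        (u : hom a' a) (v : hom b b') (f : hom (F a) b),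
      Phi a' b' (ccomp v (ccomp f (fmap F u)))
      = ccomp (fmap G v) (ccomp (Phi a b f) u)).

Notation "F ⊣ G" := (left_adjoint F G) (at level 70, no associativity).

Record pfun (X Y : Type) := PFun {
  graph : set (X * Y);
  graph_fun : forall x y z, graph (x, y) -> graph (x, z) -> y = z }.

Definition dom X Y (f : pfun X Y) : set X :=
  [set x | exists y, graph f (x, y)].

Lemma pfun_eq X Y (f g : pfun X Y) : graph f = graph g -> f = g.
Proof.
case: f g => [f fP] [g gP] /= e; subst g.
by rewrite (Prop_irrelevance fP gP).
Qed.

Lemma pdiff_subproof X Y (f g : pfun X Y) x y z :
  (graph f `\` graph g) (x, y) -> (graph f `\` graph g) (x, z) -> y = z.
Proof. by move=> [fy _] [fz _]; exact: graph_fun fy fz. Qed.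

Definition pdiff X Y (f g : pfun X Y) : pfun X Y :=
  PFun (@pdiff_subproof X Y f g).

Lemma pdres_subproof X Y (f g : pfun X Y) x y z :
  [set p | graph g p /\ dom f p.1] (x, y) ->
  [set p | graph g p /\ dom f p.1] (x, z) -> y = z.
Proof. by move=> [gy _] [gz _]; exact: graph_fun gy gz. Qed.

Definition pdres X Y (f g : pfun X Y) : pfun X Y :=
  PFun (@pdres_subproof X Y f g).

Lemma pid_subproof X (x y z : X) :
  [set p : X * X | p.1 = p.2] (x, y) -> [set p : X * X | p.1 = p.2] (x, z) ->
  y = z.
Proof. by move=> /= <- <-. Qed.

Definition pid X : pfun X X := PFun (@pid_subproof X).

Definition pcomp_graph X Y Z (g : pfun Y Z) (f : pfun X Y) : set (X * Z) :=
  [set p | exists2 y, graph f (p.1, y) & graph g (y, p.2)].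

Lemma pcomp_subproof X Y Z (g : pfun Y Z) (f : pfun X Y) x y z :
  pcomp_graph g f (x, y) -> pcomp_graph g f (x, z) -> y = z.
Proof.
move=> [u /= fu gu] [v /= fv gv]; rewrite (graph_fun fu fv) in gu.
exact: graph_fun gu gv.
Qed.

Definition pcomp X Y Z (g : pfun Y Z) (f : pfun X Y) : pfun X Z :=
  PFun (@pcomp_subproof X Y Z g f).

(* [diff a b] is a - b and [dres a b] is a ▷ b, restricting b to dom a. *)
Record alg := Alg {
  carrier :> Type;
  diff : carrier -> carrier -> carrier;
  dres : carrier -> carrier -> carrier }.

Arguments diff {A} _ _ : rename.
Arguments dres {A} _ _ : rename.

Record is_hom (A B : alg) (h : A -> B) : Prop := IsHom {
  hom_diff : forall a b, h (diff a b) = diff (h a) (h b);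
  hom_dres : forall a b, h (dres a b) = dres (h a) (h b) }.

Definition isomorphic (A B : alg) : Prop :=
  exists2 h : A -> B, is_hom h & bijective h.

Record pfalg (X Y : Type) := PFAlg {
  elts : set (pfun X Y);
  elts_nonempty : elts !=set0;
  elts_diff : forall f g, elts f -> elts g -> elts (pdiff f g);
  elts_dres : forall f g, elts f -> elts g -> elts (pdres f g) }.

Record pfelt X Y (C : pfalg X Y) := PFElt {
  pfval :> pfun X Y;
  pfvalP : elts C pfval }.

Lemma pfelt_eq X Y (C : pfalg X Y) (f g : pfelt C) :
  graph f = graph g -> f = g.
Proof.
case: f g => [f fP] [g gP] /= /pfun_eq e; subst g.
by rewrite (Prop_irrelevance fP gP).
Qed.

Coercion alg_of_pfalg X Y (C : pfalg X Y) : alg :=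
  @Alg (pfelt C)
    (fun f g => PFElt (elts_diff (pfvalP f) (pfvalP g)))
    (fun f g => PFElt (elts_dres (pfvalP f) (pfvalP g))).

Definition representable (A : alg) : Prop :=
  exists (X Y : Type) (C : pfalg X Y), isomorphic A C.

Definition meet (A : alg) (a b : A) : A := diff a (diff a b).

Definition le (A : alg) (a b : A) : Prop := meet a b = a.

(* On a representable algebra, 0 is the least element a - a. *)
Definition is_zero (A : alg) (z : A) : Prop := forall a, le z a.

Definition is_atom (A : alg) (x : A) : Prop :=
  ~ is_zero x /\ forall b, ~ is_zero b -> le b x -> b = x.

Definition atomic (A : alg) : Prop :=
  forall a : A, ~ is_zero a -> exists2 x, is_atom x & le x a.

Definition is_join (A : alg) (S : set A) (s : A) : Prop :=
  (forall a, S a -> le a s) /\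
  (forall b, (forall a, S a -> le a b) -> le s b).

Definition complete (A B : alg) (h : A -> B) : Prop :=
  forall (S : set A) (s : A), is_join S s -> is_join (h @` S) (h s).

Lemma representable_graph (A : alg) : representable A ->
  exists (X Y : Type) (r : A -> set (X * Y)),
    [/\ forall a x y z, r a (x, y) -> r a (x, z) -> y = z,
        forall a b, r a = r b -> a = b,
        forall a b, r (diff a b) = r a `\` r b &
        forall a b, r (dres a b) = [set p | r b p /\ exists y, r a (p.1, y)]].
Proof.
move=> [X [Y [C [h [hD hR] [k kK _]]]]].
exists X, Y, (fun a => graph (h a)); split.
- by move=> a x y z; exact: graph_fun.
- by move=> a b /pfelt_eq e; rewrite -(kK a) e kK.
- by move=> a b; rewrite hD.
- by move=> a b; rewrite hR.
Qed.

Section Representation.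
Variables (A : alg) (X Y : Type) (r : A -> set (X * Y)).
Hypothesis rI : forall a b, r a = r b -> a = b.
Hypothesis rD : forall a b, r (diff a b) = r a `\` r b.

Lemma rep_meet (a b : A) : r (meet a b) = r a `&` r b.
Proof. by rewrite /meet !rD setDD. Qed.

Lemma rep_le (a b : A) : le a b <-> r a `<=` r b.
Proof.
split=> [e|s]; first by rewrite -e rep_meet; exact: subIsetr.
by apply: rI; rewrite rep_meet; exact/setIidPl.
Qed.

Lemma rep_zero (a : A) : is_zero a <-> r a = set0.
Proof.
split=> [/(_ (diff a a))/rep_le|a0 b]; last by apply/rep_le; rewrite a0.
by rewrite rD setDv subset0.
Qed.

Lemma rep_nzero (a : A) : ~ is_zero a <-> r a !=set0.
Proof. by rewrite (propext (rep_zero a)) -(propext (set0P _)); split=> /eqP. Qed.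

End Representation.

Section RepresentableTheory.
Variable A : alg.
Hypothesis rA : representable A.

Lemma le_refl (a : A) : le a a.
Proof.
have [X [Y [r [_ rI rD _]]]] := representable_graph rA.
exact/(rep_le rI rD).
Qed.

Lemma le_trans (a b c : A) : le a b -> le b c -> le a c.
Proof.
have [X [Y [r [_ rI rD _]]]] := representable_graph rA.
by move=> /(rep_le rI rD) ab /(rep_le rI rD) bc; apply/(rep_le rI rD) => p /ab/bc.
Qed.

Lemma le_anti (a b : A) : le a b -> le b a -> a = b.
Proof.
have [X [Y [r [_ rI rD _]]]] := representable_graph rA.
move=> /(rep_le rI rD) ab /(rep_le rI rD) ba; apply: rI.
by apply/seteqP; split.
Qed.

Lemma le_meet (a b c : A) : le c a -> le c b -> le c (meet a b).
Proof.
have [X [Y [r [_ rI rD _]]]] := representable_graph rA.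
move=> /(rep_le rI rD) ca /(rep_le rI rD) cb; apply/(rep_le rI rD).
by rewrite (rep_meet rD) => p cp; split; [exact: ca|exact: cb].
Qed.

Lemma meet_lel (a b : A) : le (meet a b) a.
Proof.
have [X [Y [r [_ rI rD _]]]] := representable_graph rA.
by apply/(rep_le rI rD); rewrite (rep_meet rD); exact: subIsetl.
Qed.

Lemma meet_ler (a b : A) : le (meet a b) b.
Proof.
have [X [Y [r [_ rI rD _]]]] := representable_graph rA.
by apply/(rep_le rI rD); rewrite (rep_meet rD); exact: subIsetr.
Qed.

Lemma dres_le (a b : A) : le (dres a b) b.
Proof.
have [X [Y [r [_ rI rD rR]]]] := representable_graph rA.
by apply/(rep_le rI rD); rewrite rR => p [].
Qed.

Lemma dres_mono (a a' b b' : A) :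
  le a a' -> le b b' -> le (dres a b) (dres a' b').
Proof.
have [X [Y [r [_ rI rD rR]]]] := representable_graph rA.
move=> /(rep_le rI rD) ha /(rep_le rI rD) hb; apply/(rep_le rI rD).
by rewrite !rR => p [/hb ? [y /ha ?]]; split => //; exists y.
Qed.

Lemma le_zero (a b : A) : le a b -> is_zero b -> is_zero a.
Proof. by move=> ab b0 c; exact: le_trans ab (b0 c). Qed.

Lemma zero_diff (a b : A) : is_zero (diff a b) <-> le a b.
Proof.
have [X [Y [r [_ rI rD _]]]] := representable_graph rA.
rewrite (propext (rep_zero rI rD _)) (propext (rep_le rI rD _ _)) rD.
by rewrite setD_eq0.
Qed.

Lemma diff_le (a b : A) : le (diff a b) a.
Proof.
have [X [Y [r [_ rI rD _]]]] := representable_graph rA.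
by apply/(rep_le rI rD); rewrite rD => p [].
Qed.

Lemma le_diff (a b c : A) :
  le a (diff b c) <-> le a b /\ is_zero (meet a c).
Proof.
have [X [Y [r [_ rI rD _]]]] := representable_graph rA.
rewrite !(propext (rep_le rI rD _ _)) (propext (rep_zero rI rD _)).
rewrite (rep_meet rD) rD; split=> [s|[s e] p ap].
  split=> [p /s[]//|]; apply/seteqP; split=> // p [/s[]//].
split; first exact: s.
by move=> cp; have : (r a `&` r c) p by []; rewrite e.
Qed.

Lemma atom_meet (x a : A) : is_atom x -> ~ is_zero (meet x a) -> le x a.
Proof. by move=> [_ xm] n0; rewrite -(xm _ n0 (meet_lel _ _)); exact: meet_ler. Qed.

Lemma atom_le_eq (x y : A) : is_atom x -> is_atom y -> le x y -> x = y.
Proof. by move=> [x0 _] [_ ym] xy; exact: ym. Qed.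

End RepresentableTheory.

Lemma hom_meet (A B : alg) (h : A -> B) : is_hom h ->
  forall a b, h (meet a b) = meet (h a) (h b).
Proof. by move=> hh a b; rewrite /meet !(hom_diff hh). Qed.

Lemma hom_le (A B : alg) (h : A -> B) : is_hom h ->
  forall a b, le a b -> le (h a) (h b).
Proof. by move=> hh a b; rewrite /le -hom_meet// => ->. Qed.

Lemma hom_zero (A B : alg) (h : A -> B) :
  representable A -> representable B -> is_hom h ->
  forall a, is_zero a -> is_zero (h a).
Proof.
move=> rA rB hh a a0.
have -> : a = diff a a.
  by apply: (le_anti rA) => //; exact: diff_le.
by rewrite hom_diff//; apply/(zero_diff rB); exact: le_refl.
Qed.

Record atrepalg := AtRepAlgObj {
  ara_alg :> alg;
  ara_rep : representable ara_alg;
  ara_atomic : atomic ara_alg }.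

Record chom (A B : alg) := CHom {
  chom_fun :> A -> B;
  chom_hom : is_hom chom_fun;
  chom_complete : complete chom_fun }.

Lemma chom_eq (A B : alg) (h k : chom A B) : (forall a, h a = k a) -> h = k.
Proof.
case: h k => [h h1 h2] [k k1 k2] /= /funext e; subst k.
by rewrite (Prop_irrelevance h1 k1) (Prop_irrelevance h2 k2).
Qed.

Lemma is_hom_id (A : alg) : is_hom (@id A).
Proof. by []. Qed.

Lemma complete_id (A : alg) : complete (@id A).
Proof. by move=> S s; rewrite image_id. Qed.

Definition chom_id (A : alg) : chom A A := CHom (@is_hom_id A) (@complete_id A).

Lemma is_hom_comp (A B C : alg) (k : chom B C) (h : chom A B) :
  is_hom (k \o h).
Proof.
by split=> a b /=; rewrite ?(hom_diff (chom_hom _)) ?(hom_dres (chom_hom _)).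
Qed.

Lemma complete_comp (A B C : alg) (k : chom B C) (h : chom A B) :
  complete (k \o h).
Proof.
by move=> S s /(chom_complete h)/(chom_complete k); rewrite image_comp.
Qed.

Definition chom_comp (A B C : alg) (k : chom B C) (h : chom A B) : chom A C :=
  CHom (is_hom_comp k h) (complete_comp k h).

Program Definition AtRepAlg : category :=
  @Category atrepalg (fun A B => chom A B) (fun A => chom_id A)
    (fun A B C k h => chom_comp k h) _ _ _.
Next Obligation. by move=> A B f; exact: chom_eq. Qed.
Next Obligation. by move=> A B f; exact: chom_eq. Qed.
Next Obligation. by move=> A B C D f g h; exact: chom_eq. Qed.

Record qset := QSet {
  qtotal : Type;
  qbase : Type;
  qproj :> qtotal -> qbase;
  qprojP : forall x0, exists x, qproj x = x0 }.

Definition tilde (p q : qset) (phi : pfun (qtotal p) (qtotal q)) :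
    set (qbase p * qbase q) :=
  [set z | exists x y, graph phi (x, y) /\ z = (p x, q y)].

(* The graph of the restriction and co-restriction of [phi] to the fibres over
   [x0] and [y0]. *)
Definition fibre (p q : qset) (phi : pfun (qtotal p) (qtotal q))
    (x0 : qbase p) (y0 : qbase q) : set (qtotal p * qtotal q) :=
  [set z | [/\ graph phi z, p z.1 = x0 & q z.2 = y0]].

Record is_qmor (p q : qset) (phi : pfun (qtotal p) (qtotal q)) : Prop :=
  IsQMor {
    Q1 : forall x x' y y', graph phi (x, y) -> graph phi (x', y') ->
      p x = p x' -> q y = q y';
    Q2 : forall x0 y0, tilde phi (x0, y0) ->
      forall x x' y, fibre phi x0 y0 (x, y) -> fibre phi x0 y0 (x', y) ->
      x = x';
    Q3 : forall x0 y0, tilde phi (x0, y0) ->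
      forall y, q y = y0 -> exists x, fibre phi x0 y0 (x, y) }.

Record qmor (p q : qset) := QMor {
  qmor_fun :> pfun (qtotal p) (qtotal q);
  qmorP : is_qmor qmor_fun }.

Lemma qmor_eq (p q : qset) (f g : qmor p q) : graph f = graph g -> f = g.
Proof.
case: f g => [f fP] [g gP] /= /pfun_eq e; subst g.
by rewrite (Prop_irrelevance fP gP).
Qed.

Lemma qmor_inj (p q : qset) (f : pfun (qtotal p) (qtotal q)) : is_qmor f ->
  forall x x' y, graph f (x, y) -> graph f (x', y) -> p x = p x' -> x = x'.
Proof.
move=> fP x x' y fx fx' e.
have t : tilde f (p x, q y) by exists x, y.
exact: (Q2 fP t (x := x) (x' := x') (y := y)).
Qed.

Lemma qmor_lift (p q : qset) (f : pfun (qtotal p) (qtotal q)) : is_qmor f ->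
  forall x y y', graph f (x, y) -> q y' = q y ->
  exists2 x', graph f (x', y') & p x' = p x.
Proof.
move=> fP x y y' fx e.
have [|x' [? ? ?]] := Q3 fP (x0 := p x) (y0 := q y) _ e; first by exists x, y.
by exists x'.
Qed.

Lemma is_qmorP (p q : qset) (f : pfun (qtotal p) (qtotal q)) :
  (forall x x' y y', graph f (x, y) -> graph f (x', y') ->
      p x = p x' -> q y = q y') ->
  (forall x x' y, graph f (x, y) -> graph f (x', y) -> p x = p x' -> x = x') ->
  (forall x y y', graph f (x, y) -> q y' = q y ->
      exists2 x', graph f (x', y') & p x' = p x) ->
  is_qmor f.
Proof.
move=> h1 h2 h3; split=> //.
- move=> x0 y0 _ x x' y [/= fx ex _] [/= fx' ex' _].
  by apply: h2 fx fx' _; rewrite ex ex'.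
- move=> x0 y0 [x [y [fx [-> ->]]]] y' e.
  by have [x' ? ?] := h3 _ _ _ fx e; exists x'.
Qed.

Lemma qid_subproof (p : qset) : is_qmor (pid (qtotal p)).
Proof.
apply: is_qmorP => /=; first by move=> x x' y y' -> ->.
- by move=> x x' y -> ->.
- by move=> x y y' -> e; exists y'.
Qed.

Definition qid (p : qset) : qmor p p := QMor (qid_subproof p).

Lemma qcomp_subproof (p q s : qset) (g : qmor q s) (f : qmor p q) :
  is_qmor (pcomp g f).
Proof.
apply: is_qmorP => /=.
- move=> x x' z z' [y /= fy gy] [y' /= fy' gy'] e.
  by apply: Q1 (qmorP g) _ _ _ _ gy gy' _; exact: Q1 (qmorP f) _ _ _ _ fy fy' e.
- move=> x x' z [y /= fy gy] [y' /= fy' gy'] e.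
  have ey := qmor_inj (qmorP g) gy gy' (Q1 (qmorP f) fy fy' e).
  by rewrite -ey in fy'; exact: qmor_inj (qmorP f) _ _ _ fy fy' e.
- move=> x z z' [y /= fy gy] e.
  have [y' gy' ey] := qmor_lift (qmorP g) gy e.
  have [x' fx' ex] := qmor_lift (qmorP f) fy ey.
  by exists x' => //; exists y'.
Qed.

Definition qcomp (p q s : qset) (g : qmor q s) (f : qmor p q) : qmor p s :=
  QMor (qcomp_subproof g f).

Program Definition Set_q : category :=
  @Category qset qmor qid (fun p q s g f => qcomp g f) _ _ _.
Next Obligation.
move=> p q f; apply: qmor_eq; apply/seteqP; split=> [[x y] [z /= ? <-]//|].
by move=> [x y] fxy; exists y.
Qed.
Next Obligation.
move=> p q f; apply: qmor_eq; apply/seteqP; split=> [[x y] [z /= <-]//|].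
by move=> [x y] fxy; exists x.
Qed.
Next Obligation.
move=> p q s t f g h; apply: qmor_eq; apply/seteqP; split=> -[x w].
- by move=> [z [y /= ? ?] ?]; exists y => //; exists z.
- by move=> [y /= ? [z /= ? ?]]; exists z => //; exists y.
Qed.

Record At (A : alg) := Atom {
  atval :> A;
  atvalP : is_atom atval }.

Lemma At_eq (A : alg) (x y : At A) : x = y :> A -> x = y.
Proof.
case: x y => [x xP] [y yP] /= e; subst y.
by rewrite (Prop_irrelevance xP yP).
Qed.

Definition preceq (A : alg) (a b : A) : Prop := le a (dres b a).

Definition sim (A : alg) (a b : A) : Prop := preceq a b /\ preceq b a.

Lemma preceq_trans (A : alg) : representable A ->
  forall a b c : A, preceq a b -> preceq b c -> preceq a c.
Proof.
move=> rA a b c; have [X [Y [r [_ rI rD rR]]]] := representable_graph rA.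
rewrite /preceq => /(rep_le rI rD) ab /(rep_le rI rD) bc.
apply/(rep_le rI rD); move: ab bc; rewrite !rR => ab bc p ap.
have [_ [y /bc[_ [z cz]]]] := ab _ ap.
by split=> //; exists z.
Qed.

Lemma preceq_refl (A : alg) : representable A -> forall a : A, preceq a a.
Proof.
move=> rA a; have [X [Y [r [_ rI rD rR]]]] := representable_graph rA.
by apply/(rep_le rI rD); rewrite rR => -[x y] ap; split=> //; exists y.
Qed.

Definition simclass (A : alg) (x : At A) : set (At A) := [set y : At A | sim x y].

Lemma simclass_eq (A : alg) : representable A ->
  forall x y : At A, simclass x = simclass y <-> sim x y.
Proof.
move=> rA x y; split=> [e|[xy yx]].
  suff : simclass x y by [].
  by rewrite e; split; exact: preceq_refl.
apply/seteqP; split=> z [? ?]; split.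
- exact: preceq_trans yx _.
- exact: preceq_trans _ xy.
- exact: preceq_trans xy _.
- exact: preceq_trans _ yx.
Qed.

(* The quotient At(A)/~, as the set of equivalence classes. *)
Record Atq (A : alg) := SimClass {
  class :> set (At A);
  classP : exists x, class = simclass x }.

Definition at_proj (A : alg) (x : At A) : Atq A :=
  SimClass (ex_intro _ x (erefl (simclass x))).

Lemma Atq_eq (A : alg) (c d : Atq A) : c = d :> set _ -> c = d.
Proof.
case: c d => [c cP] [d dP] /= e; subst d.
by rewrite (Prop_irrelevance cP dP).
Qed.

Lemma at_proj_surj (A : alg) : forall c : Atq A, exists x, at_proj x = c.
Proof. by move=> [c [x e]]; exists x => //; apply: Atq_eq; rewrite /= e. Qed.

Lemma at_proj_eq (A : alg) : representable A ->
  forall x y : At A, at_proj x = at_proj y <-> sim x y.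
Proof.
move=> rA x y; rewrite -(simclass_eq rA); split=> [e|e].
  exact: (congr1 (@class A) e).
exact: Atq_eq.
Qed.

Definition F_obj (A : atrepalg) : qset := QSet (@at_proj_surj A).

(* [is_phi h a y x] : x is the atom phi_a(y) of the down-set of a. *)
Definition is_phi (A B : alg) (h : A -> B) (a : A) (y : At B) (x : At A) :
    Prop :=
  le x a /\ forall a' : A, le a' a -> (le x a' <-> le y (h a')).

Definition F_graph (A B : alg) (h : A -> B) : set (At B * At A) :=
  [set p : At B * At A | exists a : A, le p.1 (h a) /\ is_phi h a p.1 p.2].

Lemma is_phiP (A B : atrepalg) (h : chom A B) (a : A) (y : At B) (x : At A) :
  is_phi h a y x -> le y (h x).
Proof. by move=> [xa /(_ x xa) xP]; apply/xP; exact: (le_refl (ara_rep A)). Qed.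

Lemma phi_is_phi (A B : atrepalg) (h : chom A B) (a : A) (y : At B) (x : At A) :
  le x a -> le y (h x) -> is_phi h a y x.
Proof.
have [rA rB] := (ara_rep A, ara_rep B); have hh := chom_hom h.
move=> xa yx; split=> // a' a'a; split=> [xa'|ya'].
  exact: (le_trans rB) yx (hom_le hh xa').
apply: (atom_meet rA (atvalP x)) => m0.
have [y0 _] := atvalP y; apply: y0.
apply: (le_zero rB _ (hom_zero rA rB hh m0)).
by rewrite hom_meet//; exact: le_meet.
Qed.

Lemma F_graphP (A B : atrepalg) (h : chom A B) (y : At B) (x : At A) :
  F_graph h (y, x) <-> le y (h x).
Proof.
split=> [[a [_ /is_phiP]]//|yx]; exists x; split=> //=.
by apply: phi_is_phi => //; exact: (le_refl (ara_rep A)).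
Qed.

Lemma phi_unique (A B : atrepalg) (h : chom A B) (y : At B) (x x' : At A) :
  le y (h x) -> le y (h x') -> x = x'.
Proof.
have [rA rB] := (ara_rep A, ara_rep B); have hh := chom_hom h.
move=> yx yx'; apply: At_eq; apply: (atom_le_eq (atvalP x) (atvalP x')).
apply: (atom_meet rA (atvalP x)) => m0; have [y0 _] := atvalP y; apply: y0.
apply: (le_zero rB _ (hom_zero rA rB hh m0)).
by rewrite hom_meet//; exact: le_meet.
Qed.

Lemma is_join_atoms (A : atrepalg) (a : A) :
  is_join [set x | is_atom x /\ le x a] a.
Proof.
have rA := ara_rep A; split=> [x []//|b ub].
apply: contrapT => nab.
have nz : ~ is_zero (diff a b) by move=> /(zero_diff rA).
have [x xA xab] := ara_atomic nz.
have [xa xb] := (le_diff rA x a b).1 xab.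
have e := ub x (conj xA xa); rewrite /le in e; rewrite e in xb.
by case: xA.
Qed.

Lemma phi_exists (A B : atrepalg) (h : chom A B) (a : A) (y : At B) :
  le y (h a) -> exists2 x : At A, le x a & le y (h x).
Proof.
have [rA rB] := (ara_rep A, ara_rep B); have hh := chom_hom h.
move=> ya; apply: contrapT => nx.
have [_ hub] := chom_complete h (is_join_atoms a).
have had : le (h a) (diff (h a) y).
  apply: hub => _ [x [xA xa] <-]; apply/(le_diff rB).
  split; first exact: hom_le.
  apply: contrapT => n0; apply: nx; exists (Atom xA) => //=.
  apply: (atom_meet rB (atvalP y)) => m0; apply: n0.
  by apply: (le_zero rB _ m0); apply: (le_meet rB);
    [exact: meet_ler|exact: meet_lel].
have [_ z0] := (le_diff rB _ _ _).1 (le_trans rB ya had).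
have [y0 _] := atvalP y; apply: y0.
by apply: (le_zero rB _ z0); apply: (le_meet rB); exact: le_refl.
Qed.

(* The next two lemmas: dom (F h) consists of the atoms below some h(a), and
   (F h)(y) = phi_a(y) whenever y <= h(a), independently of a. *)
Lemma F_graph_dom (A B : atrepalg) (h : chom A B) (y : At B) :
  (exists x, F_graph h (y, x)) <-> (exists a : A, le y (h a)).
Proof.
split=> [[x /F_graphP yx]|[a /phi_exists[x _ yx]]]; first by exists x.
by exists x; apply/F_graphP.
Qed.

Lemma F_graph_phi (A B : atrepalg) (h : chom A B) (a : A) (y : At B)
    (x : At A) :
  le y (h a) -> (F_graph h (y, x) <-> is_phi h a y x).
Proof.
move=> ya; rewrite F_graphP; split=> [yx|]; last exact: is_phiP.
have [x' x'a yx'] := phi_exists ya.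
by rewrite (phi_unique yx yx'); exact: phi_is_phi.
Qed.

Lemma F_subproof (A B : atrepalg) (h : chom A B) (y : At B) (x x' : At A) :
  F_graph h (y, x) -> F_graph h (y, x') -> x = x'.
Proof. by move=> /F_graphP yx /F_graphP yx'; exact: phi_unique yx yx'. Qed.

Definition F_pfun (A B : atrepalg) (h : chom A B) : pfun (At B) (At A) :=
  PFun (@F_subproof A B h).

Lemma preceq_atoms (A B : atrepalg) (h : chom A B) (y y' : At B) (x x' : At A) :
  le y (h x) -> le y' (h x') -> preceq y y' -> preceq x x'.
Proof.
have [rA rB] := (ara_rep A, ara_rep B); have hh := chom_hom h.
move=> yx yx' yy'; rewrite /preceq.
have [x0 xm] := atvalP x.
have n0 : ~ is_zero (dres x' x : A).
  move=> /(hom_zero rA rB hh); rewrite (hom_dres hh) => z.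
  have [y0 _] := atvalP y; apply: y0; apply: (le_zero rB _ z).
  by apply: (le_trans rB yy'); exact: dres_mono.
by rewrite (xm _ n0 (dres_le rA _ _)); exact: le_refl.
Qed.

Lemma F_is_qmor (A B : atrepalg) (h : chom A B) :
  @is_qmor (F_obj B) (F_obj A) (F_pfun h).
Proof.
have [rA rB] := (ara_rep A, ara_rep B); have hh := chom_hom h.
have [X [Y [r [rF rI rD rR]]]] := representable_graph rB.
apply: is_qmorP => /=.
- move=> y y' x x' /F_graphP yx /F_graphP yx' /(at_proj_eq rB)[yy' y'y].
  by apply/(at_proj_eq rA); split; [exact: preceq_atoms yx yx' yy'|
    exact: preceq_atoms yx' yx y'y].
- move=> y y' x /F_graphP yx /F_graphP yx' /(at_proj_eq rB)[yy' y'y].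
  apply: At_eq; apply: (atom_le_eq (atvalP y) (atvalP y')).
  apply: (atom_meet rB (atvalP y)); apply/(rep_nzero rI rD).
  have [[u v] yuv] := (rep_nzero rI rD _).1 (atvalP y).1.
  move: yy'; rewrite /preceq => /(rep_le rI rD); rewrite rR => /(_ _ yuv).
  move=> [_ [w y'w]]; exists (u, v); rewrite (rep_meet rD); split=> //.
  move: yx yx' => /(rep_le rI rD)/(_ _ yuv) xv /(rep_le rI rD)/(_ _ y'w) xw.
  by rewrite (rF _ _ _ _ xv xw).
- move=> y x x' /F_graphP yx /(at_proj_eq rA)[x'x xx'].
  have ydx : le (atval y) (dres (h x') (h x)).
    by rewrite -(hom_dres hh); apply: (le_trans rB yx); exact: hom_le.
  have n0 : ~ is_zero (dres (atval y) (h x')).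
    apply/(rep_nzero rI rD).
    have [[u v] yuv] := (rep_nzero rI rD _).1 (atvalP y).1.
    move: ydx => /(rep_le rI rD); rewrite rR => /(_ _ yuv) [_ [w hw]].
    by exists (u, w); rewrite rR; split=> //; exists v.
  have [z zA zd] := ara_atomic n0.
  exists (Atom zA); first by apply/F_graphP; exact: (le_trans rB zd (dres_le rB _ _)).
  apply/(at_proj_eq rB); rewrite /sim /preceq /=.
  have zy : r z `<=` [set p | exists v, r y (p.1, v)].
    by move: zd => /(rep_le rI rD); rewrite rR => zd p /zd[].
  split.
    by apply/(rep_le rI rD); rewrite rR => p zp; split=> //; exact: zy.
  have dn0 : ~ is_zero (dres z (atval y)).
    apply/(rep_nzero rI rD); have [[u w] zuw] := (rep_nzero rI rD _).1 zA.1.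
    have [v yv] := zy _ zuw.
    by exists (u, v); rewrite rR; split=> //; exists w.
  by rewrite ((atvalP y).2 _ dn0 (dres_le rB _ _)); exact: le_refl.
Qed.

Definition F_mor (A B : atrepalg) (h : chom A B) : qmor (F_obj B) (F_obj A) :=
  @QMor (F_obj B) (F_obj A) (F_pfun h) (F_is_qmor h).

Program Definition F : functor AtRepAlg (op Set_q) :=
  @Functor AtRepAlg (op Set_q) F_obj (fun A B h => F_mor h) _ _.
Next Obligation.
move=> A; apply: qmor_eq; apply/seteqP; split=> -[y x] /=.
- move=> /(F_graphP (chom_id A)) /= yx; apply: At_eq; exact: (atom_le_eq (atvalP y) (atvalP x)).
- by move=> ->; apply/(F_graphP (chom_id A)); exact: (le_refl (ara_rep A)).
Qed.
Next Obligation.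
move=> A B C k h; apply: qmor_eq; apply/seteqP; split=> -[z x] /=.
- move=> /(F_graphP (chom_comp k h)) /= /phi_exists[y yx zy].
  by exists y; apply/F_graphP.
- move=> [y /F_graphP /= zy /F_graphP /= yx].
  apply/(F_graphP (chom_comp k h)) => /=.
  by apply: (le_trans (ara_rep C) zy); exact: (hom_le (chom_hom k)).
Qed.

Section PfalgOrder.
Variables (X Y : Type) (C : pfalg X Y).

Lemma pfalg_rep : representable C.
Proof. by exists X, Y, C, id => //; exists id. Qed.

Lemma pfalg_le (f g : C) : le f g <-> graph f `<=` graph g.
Proof.
apply: (rep_le (r := fun f : C => graph f)) => // a b; exact: pfelt_eq.
Qed.

Lemma pfalg_nzero (f : C) : ~ is_zero f <-> graph f !=set0.
Proof.
apply: (rep_nzero (r := fun f : C => graph f)) => // a b; exact: pfelt_eq.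
Qed.

End PfalgOrder.

Definition G_elts (p : qset) : set (pfun (qbase p) (qtotal p)) :=
  [set f | graph f `<=` range (fun x => (p x, x))].

Lemma G_eltsP (p : qset) (f : pfun (qbase p) (qtotal p)) :
  G_elts f <-> forall x0 x, graph f (x0, x) -> x0 = p x.
Proof.
split=> [h x0 x /h[x' _ [<- <-]]//|h [x0 x] fx].
by exists x => //; rewrite (h _ _ fx).
Qed.

Definition pempty X Y : pfun X Y :=
  @PFun X Y set0 (fun x y z (f : False) _ => False_ind _ f).

Lemma G_nonempty (p : qset) : G_elts (p := p) !=set0.
Proof. by exists (pempty _ _). Qed.

Lemma G_diff (p : qset) (f g : pfun (qbase p) (qtotal p)) :
  G_elts f -> G_elts g -> G_elts (pdiff f g).
Proof. by move=> hf _ z [/hf]. Qed.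

Lemma G_dres (p : qset) (f g : pfun (qbase p) (qtotal p)) :
  G_elts f -> G_elts g -> G_elts (pdres f g).
Proof. by move=> _ hg z [/hg]. Qed.

Definition G_alg (p : qset) : pfalg (qbase p) (qtotal p) :=
  PFAlg (@G_nonempty p) (@G_diff p) (@G_dres p).

Lemma G_point_subproof (p : qset) (x : qtotal p) x0 y z :
  [set (p x, x)] (x0, y) -> [set (p x, x)] (x0, z) -> y = z.
Proof. by move=> [_ ->] [_ ->]. Qed.

Lemma G_point_elt (p : qset) (x : qtotal p) :
  G_elts (PFun (@G_point_subproof p x)).
Proof. by move=> _ ->; exists x. Qed.

Definition G_point (p : qset) (x : qtotal p) : G_alg p :=
  @PFElt _ _ (G_alg p) _ (@G_point_elt p x).

Lemma G_atomic (p : qset) : atomic (G_alg p).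
Proof.
move=> f /pfalg_nzero[[x0 x] fx]; have e := (G_eltsP f).1 (pfvalP f) _ _ fx.
rewrite e in fx; exists (G_point x); last by apply/pfalg_le => _ ->.
split=> [|g /pfalg_nzero[z gz] /pfalg_le gx].
  by apply/pfalg_nzero; exists (p x, x).
apply: pfelt_eq; apply/seteqP; split=> // _ ->.
by rewrite -(gx _ gz).
Qed.

Definition G_obj (p : qset) : atrepalg :=
  AtRepAlgObj (pfalg_rep (G_alg p)) (@G_atomic p).

Definition G_graph (p q : qset) (phi : pfun (qtotal p) (qtotal q))
    (g : pfun (qbase q) (qtotal q)) : set (qbase p * qtotal p) :=
  [set z | exists x y, [/\ graph phi (x, y), graph g (q y, y) & z = (p x, x)]].

Lemma G_graphP (p q : qset) (phi : pfun (qtotal p) (qtotal q))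
    (g : pfun (qbase q) (qtotal q)) x0 x :
  G_graph phi g (x0, x) <->
  x0 = p x /\ exists2 y, graph phi (x, y) & graph g (q y, y).
Proof.
split=> [[x' [y [? ? [-> ->]]]]|[-> [y ? ?]]]; last by exists x, y.
by split=> //; exists y.
Qed.

Lemma G_subproof (p q : qset) (phi : qmor p q) (g : G_alg q) x0 x x' :
  G_graph phi g (x0, x) -> G_graph phi g (x0, x') -> x = x'.
Proof.
move=> /G_graphP[-> [y xy gy]] /G_graphP[e [y' xy' gy']].
have ey := Q1 (qmorP phi) xy xy' e; rewrite -ey in gy'.
have eyy := graph_fun gy gy'; rewrite -eyy in xy'.
exact: qmor_inj (qmorP phi) _ _ _ xy xy' e.
Qed.

Lemma G_mor_elt (p q : qset) (phi : qmor p q) (g : G_alg q) :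
  G_elts (PFun (@G_subproof p q phi g)).
Proof. by apply/G_eltsP => x0 x /G_graphP[]. Qed.

Definition G_fun (p q : qset) (phi : qmor p q) (g : G_alg q) : G_alg p :=
  @PFElt _ _ (G_alg p) _ (@G_mor_elt p q phi g).

Lemma G_is_hom (p q : qset) (phi : qmor p q) :
  @is_hom (G_alg q) (G_alg p) (G_fun phi).
Proof.
split=> f g; apply: pfelt_eq; apply/seteqP; split=> -[x0 x] /=.
- move=> /G_graphP[-> [y xy [fy ngy]]]; split.
    by apply/G_graphP; split=> //; exists y.
  move=> /G_graphP[_ [y' xy' gy']]; apply: ngy.
  by rewrite (graph_fun xy xy').
- move=> [/G_graphP[-> [y xy fy]] ng]; apply/G_graphP; split=> //.
  exists y => //; split=> // gy; apply: ng; apply/G_graphP; split=> //.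
  by exists y.
- move=> /G_graphP[-> [y xy [gy [y' /= fy']]]]; split.
    by apply/G_graphP; split=> //; exists y.
  have ey := (G_eltsP f).1 (pfvalP f) _ _ fy'.
  have [x' xy' ex] := qmor_lift (qmorP phi) xy (esym ey).
  by exists x'; apply/G_graphP; split=> //; exists y' => //; rewrite -ey.
- move=> [/G_graphP[-> [y xy gy]] [x' /G_graphP[e [y' xy' fy']]]].
  apply/G_graphP; split=> //; exists y => //; split=> //=.
  by exists y'; rewrite (Q1 (qmorP phi) xy xy' e).
Qed.

Lemma G_join (p : qset) (S : set (G_alg p)) (s : G_alg p) :
  is_join S s -> forall z, graph s z -> exists2 f, S f & graph f z.
Proof.
move=> [ub lub] [x0 x] sx; apply: contrapT => nS.
have e := (G_eltsP s).1 (pfvalP s) _ _ sx.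
have : le s (diff s (G_point x)).
  apply: lub => f Sf; apply/pfalg_le => z fz; split.
    exact: (pfalg_le f s).1 (ub _ Sf) _ fz.
  by move=> /= ez; apply: nS; exists f => //; rewrite e -ez.
by move=> /pfalg_le /(_ _ sx)[_]; apply; rewrite e.
Qed.

Lemma G_complete (p q : qset) (phi : qmor p q) :
  @complete (G_alg q) (G_alg p) (G_fun phi).
Proof.
move=> S s sS; split=> [_ [f Sf <-]|b ub].
  by apply: (hom_le (G_is_hom phi)); exact: sS.1.
apply/pfalg_le => -[x0 x] /G_graphP[-> [y xy /(G_join sS)[f Sf fy]]].
have /pfalg_le := ub (G_fun phi f) (ex_intro2 _ _ f Sf erefl); apply.
by apply/G_graphP; split=> //; exists y.
Qed.

Definition G_mor (p q : qset) (phi : qmor p q) : chom (G_obj q) (G_obj p) :=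
  CHom (G_is_hom phi) (@G_complete p q phi).

Program Definition G : functor (op Set_q) AtRepAlg :=
  @Functor (op Set_q) AtRepAlg G_obj (fun q p phi => G_mor phi) _ _.
Next Obligation.
move=> p; apply: chom_eq => f; apply: pfelt_eq; apply/seteqP.
split=> -[x0 x] /=; first by move=> /G_graphP[-> [y /= <-]].
move=> fx; have e := (G_eltsP f).1 (pfvalP f) _ _ fx.
by apply/G_graphP; split=> //; exists x => //; rewrite -e.
Qed.
Next Obligation.
move=> s q p phi psi; apply: chom_eq => f; apply: pfelt_eq; apply/seteqP.
split=> -[x0 x] /=.
- move=> /G_graphP[-> [z [y /= xy yz] fz]]; apply/G_graphP; split=> //.
  by exists y => //; apply/G_graphP; split=> //; exists z.
- move=> /G_graphP[-> [y xy /G_graphP[_ [z yz fz]]]]; apply/G_graphP.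
  by split=> //; exists z => //; exists y.
Qed.

(* Main.v *)
From mathcomp Require Import all_boot boolp classical_sets.
Require Import Defs.

(** The adjunction is exhibited by its unit and counit.

    The unit at an atomic representable algebra A sends a to the set of atoms
    below a, encoded as the partial function taking a class of atoms to its
    member below a.  It is single-valued because two equivalent atoms below a
    common element coincide ([sim_atoms_below]): represented by partial
    functions, they share a point of their domains, and a takes a single value
    there.  It is a complete homomorphism because being above a given atom is
    compatible with difference ([atom_le_diff]), with joins ([atom_le_join]),
    and with domain restriction up to equivalence of atoms ([atom_le_dres]).

    The counit at p : X ->> X0 is the morphism of [Set_q] from p to F (G p)
    sending x to the one-point partial function (p x, x).  The atoms of G p are
    exactly these points ([G_atomP]), and two of them are equivalent exactly
    when they lie in the same fibre of p ([G_point_sim]), so the counit is even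
    an isomorphism.

    Through [F_graphP], naturality and the triangle identities all reduce to
    deciding when an atom or a point lies below a given element. *)

Set Implicit Arguments.
Unset Strict Implicit.
Unset Printing Implicit Defensive.

Local Open Scope classical_set_scope.

(** * Adjunctions from a unit and a counit *)

(** Transposition sends f to G f after the unit and its inverse sends g to the
    counit after F g; naturality moves the unit or the counit past f or g, and a
    triangle identity then cancels the pair. *)
Lemma unit_counit_left_adjoint (C D : category)
    (F : functor C D) (G : functor D C)
    (eta : forall a : C, hom a (G (F a))) (eps : forall b : D, hom (F (G b)) b) :
  (forall (a a' : C) (u : hom a' a),
    ccomp (eta a) u = ccomp (fmap G (fmap F u)) (eta a')) ->
  (forall (b b' : D) (v : hom b b'),
    ccomp v (eps b) = ccomp (eps b') (fmap F (fmap G v))) ->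
  (forall a, ccomp (eps (F a)) (fmap F (eta a)) = idc (F a)) ->
  (forall b, ccomp (fmap G (eps b)) (eta (G b)) = idc (G b)) ->
  F ⊣ G.
Proof.
move=> eta_nat eps_nat triF triG.
exists (fun a b (f : hom (F a) b) => ccomp (fmap G f) (eta a)); split.
- move=> a b; exists (fun g : hom a (G b) => ccomp (eps b) (fmap F g)).
  + by move=> f; rewrite fmapD compA -eps_nat -compA triF compc1.
  + by move=> g; rewrite fmapD -compA -eta_nat compA triG comp1c.
- by move=> a a' b b' u v f; rewrite !fmapD -!compA -eta_nat.
Qed.

(** * Atoms of a representable algebra *)

Section Atoms.
Variable A : alg.
Hypothesis rA : representable A.

Lemma sim_atoms_below (a : A) (x y : At A) :
  le x a -> le y a -> sim x y -> x = y.
Proof.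
have [X [Y [r [rF rI rD rR]]]] := representable_graph rA.
move=> /(rep_le rI rD) xa /(rep_le rI rD) ya [xy _].
apply: At_eq; apply: (atom_le_eq (atvalP x) (atvalP y)).
apply: (atom_meet rA (atvalP x)); apply/(rep_nzero rI rD).
have [[u v] xuv] := (rep_nzero rI rD _).1 (atvalP x).1.
move: xy => /(rep_le rI rD); rewrite rR => /(_ _ xuv) [_ [w yuw]].
exists (u, v); rewrite (rep_meet rD); split=> //.
by rewrite (rF _ _ _ _ (xa _ xuv) (ya _ yuw)).
Qed.

Lemma atom_le_diff (x : At A) (a b : A) :
  le x (diff a b) <-> le x a /\ ~ le x b.
Proof.
rewrite (propext (le_diff rA _ _ _)); split=> -[xa xb]; split=> //.
  by move=> e; move: xb; rewrite e; exact: (atvalP x).1.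
by apply: contrapT => /(atom_meet rA (atvalP x)).
Qed.

(** An atom is join-prime: if it missed every member of S, removing it from the
    join would leave a smaller upper bound. *)
Lemma atom_le_join (x : At A) (S : set A) (s : A) :
  is_join S s -> le x s -> exists2 a, S a & le x a.
Proof.
move=> [ub lub] xs; apply: contrapT => nS.
suff /(le_trans rA xs)/atom_le_diff[_] : le s (diff s x).
  by apply; exact: le_refl.
apply: lub => a Sa; apply/(le_diff rA); split; first exact: ub.
apply: contrapT => nz; apply: nS; exists a => //.
apply: (atom_meet rA (atvalP x)) => z; apply: nz.
by apply: (le_zero rA _ z); apply: (le_meet rA);
  [exact: meet_ler|exact: meet_lel].
Qed.

(** On atoms the preorder is symmetric: dres z x is a nonzero element below x,
    hence x itself. *)
Lemma preceq_atom_sim (x z : At A) : preceq z x -> sim z x.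
Proof.
have [X [Y [r [_ rI rD rR]]]] := representable_graph rA.
move=> zx; split=> //; rewrite /preceq.
have nz : ~ is_zero (dres z x : A).
  apply/(rep_nzero rI rD).
  have [[u v] zuv] := (rep_nzero rI rD _).1 (atvalP z).1.
  move: zx => /(rep_le rI rD); rewrite rR => /(_ _ zuv) [_ [w xuw]].
  by exists (u, w); rewrite rR; split=> //; exists v.
by rewrite ((atvalP x).2 _ nz (dres_le rA _ _)); exact: le_refl.
Qed.

End Atoms.

(** The part of a over the domain of x is nonzero as soon as x lies below
    dres a b, so atomicity provides an atom of a equivalent to x. *)
Lemma atom_le_dres (A : atrepalg) (x : At A) (a b : A) :
  le x (dres a b) <-> le x b /\ exists2 y : At A, sim x y & le y a.
Proof.
have rA := ara_rep A.
have [X [Y [r [_ rI rD rR]]]] := representable_graph rA.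
split=> [xab|[xb [y [xy _] ya]]]; last first.
  exact: (le_trans rA xy (dres_mono rA ya xb)).
split; first exact: (le_trans rA xab (dres_le rA _ _)).
have nz : ~ is_zero (dres (atval x) a).
  apply/(rep_nzero rI rD).
  have [[u v] xuv] := (rep_nzero rI rD _).1 (atvalP x).1.
  move: xab => /(rep_le rI rD); rewrite rR => /(_ _ xuv) [_ [w auw]].
  by exists (u, w); rewrite rR; split=> //; exists v.
have [y yA yxa] := ara_atomic nz.
exists (Atom yA); last exact: (le_trans rA yxa (dres_le rA _ _)).
suff /(preceq_atom_sim rA)[] : preceq (Atom yA) x by split.
apply/(rep_le rI rD) => p yp; rewrite rR; split=> //.
by move: yxa => /(rep_le rI rD) /(_ _ yp); rewrite rR => -[].
Qed.

(** * The unit *)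

Section Unit.
Variable A : atrepalg.
Let rA := ara_rep A.

Lemma eta_subproof (a : A) c (x y : At A) :
  [set z : Atq A * At A | z.1 = at_proj z.2 /\ le z.2 a] (c, x) ->
  [set z : Atq A * At A | z.1 = at_proj z.2 /\ le z.2 a] (c, y) -> x = y.
Proof.
move=> [/= -> xa] [/= /(at_proj_eq rA) xy ya].
exact: (sim_atoms_below rA xa ya xy).
Qed.

Lemma eta_elt (a : A) : @G_elts (F_obj A) (PFun (@eta_subproof a)).
Proof. by apply/(@G_eltsP (F_obj A)) => c x [/= ->]. Qed.

Definition eta_fun (a : A) : G_alg (F_obj A) :=
  @PFElt _ _ (G_alg (F_obj A)) _ (@eta_elt a).

Lemma eta_is_hom : @is_hom A (G_alg (F_obj A)) eta_fun.
Proof.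
split=> a b; apply: pfelt_eq; apply/seteqP; split=> -[c x] /=.
- by move=> [-> /(atom_le_diff rA)[xa xb]]; split=> // -[].
- move=> [[-> xa] xb]; split=> //; apply/(atom_le_diff rA); split=> //.
  by move=> xb'; apply: xb.
- move=> [-> /atom_le_dres[xb [y xy ya]]]; split=> //.
  by exists y; split=> //=; apply/(at_proj_eq rA).
- move=> [[-> xb] [y [/= /(at_proj_eq rA) xy ya]]]; split=> //.
  by apply/atom_le_dres; split=> //; exists y.
Qed.

Lemma eta_complete : @complete A (G_alg (F_obj A)) eta_fun.
Proof.
move=> S s sS; split=> [_ [a Sa <-]|g ub].
  by apply: (hom_le eta_is_hom); exact: sS.1.
apply/pfalg_le => -[c x] [/= -> /(atom_le_join rA sS)[a Sa xa]].
have /pfalg_le := ub (eta_fun a) (ex_intro2 _ _ a Sa erefl); exact.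
Qed.

Definition eta : chom A (G_obj (F_obj A)) := CHom eta_is_hom eta_complete.

End Unit.

(** * The counit *)

Section Counit.
Variable p : qset.

Lemma G_point_le (x : qtotal p) (f : G_alg p) :
  le (G_point x) f <-> graph f (p x, x).
Proof. by rewrite (propext (pfalg_le _ _)); split=> [|fx _ ->//]; exact. Qed.

Lemma G_point_atom (x : qtotal p) : is_atom (G_point x).
Proof.
split=> [|g /pfalg_nzero[z gz] /pfalg_le gx].
  by apply/pfalg_nzero; exists (p x, x).
apply: pfelt_eq; apply/seteqP; split=> // _ ->.
by rewrite -(gx _ gz).
Qed.

Definition G_pointAt (x : qtotal p) : At (G_alg p) := Atom (G_point_atom x).

Lemma G_atomP (f : At (G_alg p)) : exists x, f = G_pointAt x.
Proof.
have /pfalg_nzero[[x0 x] fx] := (atvalP f).1.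
have e := (G_eltsP (atval f)).1 (pfvalP (atval f)) _ _ fx.
exists x; apply: At_eq; apply: esym; apply: (atvalP f).2.
  exact: (G_point_atom x).1.
by apply/G_point_le; rewrite -e.
Qed.

Lemma G_point_inj (x x' : qtotal p) : G_pointAt x = G_pointAt x' -> x = x'.
Proof.
move=> e; have /G_point_le[//] : le (G_point x) (G_point x').
by rewrite -[G_point x']/(atval (G_pointAt x')) -e; exact: (le_refl (pfalg_rep _)).
Qed.

Lemma G_point_sim (x x' : qtotal p) :
  sim (G_pointAt x : G_alg p) (G_pointAt x') <-> p x = p x'.
Proof.
split=> [[/G_point_le /= [_ [y [e _]]] _]//|e].
by split; apply/G_point_le; split=> //=;
  [exists x'; rewrite /= e|exists x; rewrite /= e].
Qed.

Lemma eps_subproof (x : qtotal p) (f g : At (G_alg p)) :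
  [set z | z.2 = G_pointAt z.1] (x, f) ->
  [set z | z.2 = G_pointAt z.1] (x, g) -> f = g.
Proof. by move=> /= -> ->. Qed.

Lemma eps_is_qmor : @is_qmor p (F_obj (G_obj p)) (PFun eps_subproof).
Proof.
have proj_eq := at_proj_eq (pfalg_rep (G_alg p)).
apply: is_qmorP => /=.
- by move=> x x' _ _ -> -> e; apply/proj_eq/G_point_sim.
- by move=> x x' _ -> /G_point_inj.
- move=> x _ f -> /proj_eq; have [x' ->] := G_atomP f.
  by move=> /G_point_sim e; exists x'.
Qed.

Definition eps : qmor p (F_obj (G_obj p)) :=
  @QMor p (F_obj (G_obj p)) (PFun eps_subproof) eps_is_qmor.

End Counit.

(** * The adjunction *)

(** Both sides at a consist of the atoms below u a: by completeness of u, in the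
    form of [phi_exists], F u sends each of them to an atom below a. *)
Lemma eta_natural (A B : atrepalg) (u : chom B A) :
  chom_comp (eta A) u = chom_comp (G_mor (F_mor u)) (eta B).
Proof.
apply: chom_eq => a; apply: pfelt_eq; apply/seteqP; split=> -[c x] /=.
- move=> [-> /phi_exists[y ya xy]]; apply/(@G_graphP (F_obj A) (F_obj B)).
  by split=> //; exists y => //; apply/F_graphP.
- move=> /(@G_graphP (F_obj A) (F_obj B))[-> [y /F_graphP xy [_ ya]]].
  by split=> //; exact: (le_trans (ara_rep A) xy (hom_le (chom_hom u) ya)).
Qed.

Lemma eps_natural (p q : qset) (phi : qmor p q) :
  qcomp (eps q) phi = qcomp (F_mor (G_mor phi)) (eps p).
Proof.
apply: qmor_eq; apply/seteqP; split=> -[x f] /=.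
- move=> [y /= xy ->]; exists (G_pointAt x) => //.
  apply/(F_graphP (G_mor phi))/G_point_le/G_graphP; split=> //.
  by exists y.
- move=> [_ /= -> /(F_graphP (G_mor phi))/G_point_le/G_graphP[_ [y xy]]].
  have [y' ->] := G_atomP f; move=> [_ ey].
  by exists y => //=; rewrite ey.
Qed.

Lemma F_eta_eps (A : atrepalg) :
  qcomp (F_mor (eta A)) (eps (F_obj A)) = qid (F_obj A).
Proof.
apply: qmor_eq; apply/seteqP; split=> -[x y] /=.
- move=> [_ /= -> /(F_graphP (eta A))/(@G_point_le (F_obj A))[_ xy]].
  exact/At_eq/(atom_le_eq (atvalP x) (atvalP y)).
- move=> <-; exists (@G_pointAt (F_obj A) x) => //.
  apply/(F_graphP (eta A))/(@G_point_le (F_obj A)); split=> //.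
  exact: (le_refl (ara_rep A)).
Qed.

Lemma G_eps_eta (p : qset) :
  chom_comp (G_mor (eps p)) (eta (G_obj p)) = chom_id (G_obj p).
Proof.
apply: chom_eq => f; apply: pfelt_eq; apply/seteqP; split=> -[x0 x] /=.
- move=> /(@G_graphP p (F_obj (G_obj p)))[-> [_ /= -> [_]]].
  by move=> /G_point_le.
- move=> fx; have e := (G_eltsP f).1 (pfvalP f) _ _ fx.
  apply/(@G_graphP p (F_obj (G_obj p))); split=> //.
  exists (G_pointAt x) => //; split=> //.
  by apply/G_point_le; rewrite -e.
Qed.

Theorem theorem3p9 : F ⊣ G.
Proof.
apply: (@unit_counit_left_adjoint AtRepAlg (op Set_q) F G eta eps).
- by move=> A B u; exact: eta_natural.
- by move=> q p phi; exact: eps_natural.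
- exact: F_eta_eps.
- exact: G_eps_eta.
Qed.
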